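(* Let $n\ge 1$ and let $\varepsilon=(\varepsilon_1,\dots,\varepsilon_n)$ be the vector of spins in the Curie-Weiss model with parameters $d,\beta,h$. Let $$Q_n^{+}=\sup_{x\in\mathbb{R}}\ \sup_{v_1,\dots,v_n\ge 1}P\Big(\sum_{i=1}^n v_i\varepsilon_i\in(x-1,x+1)\Big).$$ Then $$Q_n^{+}=\sup_{x\in\mathbb{R}}P(\varepsilon_1+\cdots+\varepsilon_n\in(x-1,x+1))=\sup_{x\in\mathbb{R}}P(\varepsilon_1+\cdots+\varepsilon_n=x)$$ $$=\max_{k=0,1,\dots,n}\binom nk\frac{1}{Z_{d,\beta,h}}\exp\Big\{\frac{d\beta}{n}(2k-n)^2+h(2k-n)\Big\};$$ that is, $Q_n^{+}$ is attained for $v_1=v_2=\cdots=v_n=1$.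
   Context: Curie-Weiss model: let $d\ge 1$ be an integer, $\beta\ge 0$ and $h\in\mathbb{R}$. The spin vector $\varepsilon=(\varepsilon_1,\dots,\varepsilon_n)$ takes values in $\{-1,1\}^n$ with, for $\sigma\in\{-1,1\}^n$, $$P(\varepsilon=\sigma)=\frac{1}{Z_{d,\beta,h}}\exp\Big\{\frac{d\beta}{n}\Big(\sum_{j=1}^n\sigma_j\Big)^2+h\sum_{j=1}^n\sigma_j\Big\},$$ where $Z_{d,\beta,h}$ (depending on $n$) is the normalizing constant. *)

(* Defs.v *)
From HB Require Import structures.
From mathcomp Require Import all_boot all_order all_algebra.
From mathcomp Require Import all_classical all_reals all_analysis.

Set Implicit Arguments.
Unset Strict Implicit.
Unset Printing Implicit Defensive.

Import Order.TTheory GRing.Theory Num.Theory.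
Import numFieldNormedType.Exports.

Local Open Scope classical_set_scope.
Local Open Scope ring_scope.

(* A point of {-1,1}^n is encoded by c : {ffun 'I_n -> bool}; its j-th
   coordinate is spin R (c j). *)
Definition spin (R : realType) (b : bool) : R := if b then 1 else -1.

Section CurieWeiss.
Context {R : realType}.
Variables (n d : nat) (beta h : R).

(* The unnormalised weight of a configuration of total magnetisation m. *)
Definition cw_weight (m : R) : R :=
  expR (d%:R * beta / n%:R * m ^+ 2 + h * m).

Definition magnetisation (c : {ffun 'I_n -> bool}) : R :=
  \sum_(j < n) spin R (c j).

Definition cw_Z : R :=
  \sum_(c : {ffun 'I_n -> bool}) cw_weight (magnetisation c).

Definition curie_weiss {disp : measure_display} {T : measurableType disp}
    (P : probability T R) (eps : 'I_n -> {RV P >-> R}) : Prop :=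
  (forall (i : 'I_n) (w : T), eps i w = -1 \/ eps i w = 1) /\
  (forall c : {ffun 'I_n -> bool},
     P [set w | forall i, eps i w = spin R (c i)] =
     ((cw_Z)^-1 * cw_weight (magnetisation c))%:E).

End CurieWeiss.

(* The supremum is taken in the extended reals, where it always exists. *)
Definition Qplus {R : realType} {n : nat} {disp : measure_display}
    {T : measurableType disp} (P : probability T R)
    (eps : 'I_n -> {RV P >-> R}) : \bar R :=
  ereal_sup [set ereal_sup
      [set P [set w | \sum_(i < n) v i * eps i w \in `]x - 1, x + 1[]
        | v in [set v : 'I_n -> R | forall i, 1 <= v i]]
    | x in [set: R]].

(* Main.v *)
Require Import Defs.
From HB Require Import structures.
From mathcomp Require Import all_boot all_order all_algebra.
From mathcomp Require Import all_classical all_reals all_analysis.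
From mathcomp Require Import lra ring.

Set Implicit Arguments.
Unset Strict Implicit.
Unset Printing Implicit Defensive.

Import Order.TTheory GRing.Theory Num.Theory.
Import numFieldNormedType.Exports.

(** The proof is Erdos' treatment of the Littlewood-Offord problem, with the
    uniform law replaced by an exchangeable one.  Encode a configuration by the
    set A of sites carrying spin +1.  As every v i is at least 1, adding a site
    to A raises the weighted sum by at least 2, the length of the open interval
    `]x - 1, x + 1[; hence the sets A whose weighted sum falls in that interval
    form an antichain ([signed_sum_antichain]).

    The Curie-Weiss law gives A a probability p #|A| depending on the
    cardinality only.  Writing p k = ('C(n, k) * p k) / 'C(n, k), the
    Lubell-Yamamoto-Meshalkin inequality, which bounds by 1 the sum of
    1 / 'C(n, #|A|) over an antichain, turns this into the upper bound
    max_k 'C(n, k) * p k ([antichain_weight_le], [prob_ball_le]).  For unit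
    weights, 'C(n, k) * p k is exactly the probability that the sum of the
    spins equals 2 k - n ([prob_sum_eps_eq]), so choosing a maximizing k shows
    that the bound is attained already by a point probability; all the
    quantities in the theorem lie between the two. *)

Local Open Scope classical_set_scope.
Local Open Scope ring_scope.

(** * Antichains of finite sets *)

(** Induction on #|D|.  If D belongs to the antichain then it is its only
    member.  Otherwise each member A avoids #|D| - #|A| > 0 elements j of D, and
    #|D| / 'C(#|D|, #|A|) = (#|D| - #|A|) / 'C(#|D| - 1, #|A|), so that the sum
    is the average over j in D of the sums for the traces
    [set A in F | j \notin A] on D :\ j. *)
Lemma lubell_yamamoto_meshalkin (R : realFieldType) (T : finType) (D : {set T})
    (F : {set {set T}}) :
    (forall A, A \in F -> A \subset D) ->
    {in F &, forall A B : {set T}, A \subset B -> A = B} ->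
  \sum_(A in F) ('C(#|D|, #|A|)%:R^-1 : R) <= 1.
Proof.
move En : #|D| => n; elim: n => [|n IHn] in D F En * => FD Fanti.
(* The case D \in F is the same in the base case and in the inductive step. *)
all: case: (boolP (D \in F)) => [DF|DF].
1,3: rewrite (big_pred1 D) ?En ?binn ?invr1// => A; apply/idP/eqP => [AF|->//];
  by apply: Fanti => //; exact: FD.
  rewrite big_pred0// => A; apply/negP => AF; move: DF; apply/negP/negPn.
  have := FD _ AF; rewrite (cards0_eq En) finset.subset0 => /eqP A0.
  by rewrite -A0.
rewrite -(ler_pM2l (ltr0Sn R n)) mulr1 mulr_sumr.
have shift A : A \in F -> n.+1%:R * ('C(n.+1, #|A|)%:R : R)^-1 =
    \sum_(j in D :\: A) 'C(n, #|A|)%:R^-1.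
  move=> AF; have AD := FD _ AF.
  have ltA : (#|A| < n.+1)%N.
    rewrite -En proper_card// finset.properEneq AD andbT.
    by apply: contraNneq DF => <-.
  rewrite sumr_const cardsD (finset.setIidPr AD) En -[RHS]mulr_natl.
  apply/eqP; rewrite eqr_div ?pnatr_eq0 -?lt0n ?bin_gt0//; last exact: ltnW.
  by rewrite -!natrM mul_bin_down.
rewrite (eq_bigr _ shift).
rewrite (exchange_big_dep (mem D)) /=; last by move=> A j _ /finset.setDP[].
have -> : n.+1%:R = \sum_(j in D) 1 :> R by rewrite sumr_const En.
apply: ler_sum => j jD.
rewrite (eq_bigl (mem [set A in F | j \notin A]%SET)); last first.
  by move=> A; rewrite !inE jD andbT.
apply: (IHn (D :\ j)).
- by have := cardsD1 j D; rewrite jD En => -[].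
- by move=> A; rewrite inE => /andP[AF jA]; rewrite subsetD1 FD.
- by move=> A B; rewrite !inE => /andP[AF _] /andP[BF _]; exact: Fanti.
Qed.

(** An antichain weighs at most as much as the heaviest level of the Boolean
    lattice, for any weight constant on levels: p k is at most
    M / 'C(#|T|, k). *)
Lemma antichain_weight_le (R : realFieldType) (T : finType) (F : {set {set T}})
    (p : nat -> R) (M : R) :
    {in F &, forall A B : {set T}, A \subset B -> A = B} ->
    0 <= M -> (forall k, (k <= #|T|)%N -> 'C(#|T|, k)%:R * p k <= M) ->
  \sum_(A in F) p #|A| <= M.
Proof.
move=> Fanti M0 pM.
apply: (@le_trans _ _ (\sum_(A in F) M * 'C(#|T|, #|A|)%:R^-1)).
  apply: ler_sum => A _; have leA : (#|A| <= #|T|)%N := max_card _.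
  by rewrite ler_pdivlMr ?ltr0n ?bin_gt0// mulrC pM.
rewrite -mulr_sumr -[leRHS]mulr1 ler_wpM2l//.
rewrite -cardsT; apply: lubell_yamamoto_meshalkin => // A _.
Qed.

(** * Weighted sums of signs *)

Section SignedSums.
Variables (R : realType) (n : nat).
Implicit Types (v : 'I_n -> R) (A B : {set 'I_n}).

Definition signed_sum v A : R := \sum_(i < n) v i * spin R (i \in A).

(** Each i in B :\: A contributes 2 * v i >= 2 to the difference. *)
Lemma signed_sum_proper v A B :
  (forall i, 1 <= v i) -> A \proper B -> signed_sum v A + 2 <= signed_sum v B.
Proof.
move=> v1 /properP[/fintype.subsetP AB [j jB jA]].
rewrite addrC -lerBrDr -sumrB (bigD1 j)//= jB (negPf jA) -[leLHS]addr0 lerD//.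
  by rewrite /spin; have := v1 j; lra.
apply: sumr_ge0 => i _; have := v1 i; have := AB i; rewrite /spin.
by case: (i \in A) => [->//|_]; case: (i \in B) => ?; lra.
Qed.

(** Two comparable distinct sets have sums at distance at least 2, which two
    points of an open interval of length 2 cannot achieve. *)
Lemma signed_sum_antichain v (x : R) : (forall i, 1 <= v i) ->
  {in [set A | signed_sum v A \in `]x - 1, x + 1[]%SET &,
    forall A B, A \subset B -> A = B}.
Proof.
move=> v1 A B; rewrite !finset.in_set !in_itv/= => /andP[xA _] /andP[_ Bx] AB.
apply/eqP/negPn/negP => neqAB.
have : A \proper B by rewrite finset.properEneq neqAB.
by move=> /(signed_sum_proper v1); lra.
Qed.

Lemma signed_sum1 A : signed_sum (fun=> 1) A = 2 * #|A|%:R - n%:R.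
Proof.
rewrite /signed_sum (eq_bigr (fun i => 2 * (i \in A)%:R - 1)); last first.
  by move=> i _; rewrite mul1r /spin; case: (i \in A) => /=; ring.
rewrite sumrB -mulr_sumr -natr_sum sumr_const card_ord.
by rewrite -sum1_card [in RHS]big_mkcond.
Qed.

End SignedSums.

(** * The law of the set of positive spins *)

Section CurieWeissLaw.
Context {R : realType} {n d : nat} {beta h : R}.
Context {disp : measure_display} {T : measurableType disp} {P : probability T R}.
Variable eps : 'I_n -> {RV P >-> R}.
Hypothesis heps : curie_weiss d beta h eps.

Definition plus_spins (w : T) : {set 'I_n} := [set i | eps i w == 1]%SET.

(** The probability of each configuration with k spins equal to +1: its total
    magnetisation is k - (n - k). *)
Definition cw_atom (k : nat) : R :=
  (cw_Z n d beta h)^-1 * cw_weight n d beta h (2 * k%:R - n%:R).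

Lemma spin_eq1 b : (spin R b == 1) = b.
Proof.
case: b; rewrite /spin ?eqxx//.
(* 1 <> -1 amounts to 2 <> 0, which holds in characteristic 0. *)
by rewrite eq_sym -subr_eq0 opprK (_ : 1 + 1 = 2%:R) ?pnatr_eq0// -natrD.
Qed.

Lemma plus_spinsE w i : eps i w = spin R (i \in plus_spins w).
Proof.
by rewrite inE; have [->|->] := heps.1 i w;
  [rewrite (spin_eq1 false) | rewrite eqxx].
Qed.

Lemma plus_spins_eq (A : {set 'I_n}) w :
  plus_spins w = A <-> forall i, eps i w = spin R (i \in A).
Proof.
split=> [<- i|epsA]; first exact: plus_spinsE.
by apply/setP => i; rewrite inE epsA spin_eq1.
Qed.

Lemma measurable_plus_spins (A : {set 'I_n}) :
  measurable [set w | plus_spins w = A].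
Proof.
have -> : [set w | plus_spins w = A] =
    \bigcap_(i in [set: 'I_n]) (eps i @^-1` [set spin R (i \in A)]).
  apply/seteqP; split=> [w /plus_spins_eq epsA i _|w epsA]; first exact: epsA.
  by apply/plus_spins_eq => i; exact: epsA.
apply: fin_bigcap_measurable; first exact: finite_finset.
by move=> i _; exact: measurable_funPTI.
Qed.

Lemma prob_plus_spins (A : {set 'I_n}) :
  P [set w | plus_spins w = A] = (cw_atom #|A|)%:E.
Proof.
have -> : [set w | plus_spins w = A] =
    [set w | forall i, eps i w = spin R ([ffun i => i \in A] i)].
  apply/seteqP; split=> [w /plus_spins_eq epsA i /=|w /= epsA].
    by rewrite ffunE.
  by apply/plus_spins_eq => i; rewrite epsA ffunE.
rewrite heps.2 /cw_atom -signed_sum1 /magnetisation /signed_sum.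
do 3 congr (_ _); apply: eq_bigr => i _; by rewrite ffunE mul1r.
Qed.

Lemma prob_plus_spins_in (E : pred {set 'I_n}) :
  P [set w | E (plus_spins w)] = (\sum_(A | E A) cw_atom #|A|)%:E.
Proof.
have -> : [set w | E (plus_spins w)] =
    \bigcup_(A in [set` E]) [set w | plus_spins w = A].
  by apply/seteqP; split=> [w Ew|w [A EA /= ->]//]; exists (plus_spins w).
rewrite measure_fin_bigcup//=.
- rewrite -sumEFin (bigfs _ _ (r := index_enum _))//=.
  + by apply: eq_fsbigr => A _; rewrite prob_plus_spins.
  + exact: index_enum_uniq.
  + by move=> A _; rewrite mem_index_enum.
- by move=> A B _ _ [w [/= <- <-]].
- by move=> A _; exact: measurable_plus_spins.
Qed.

Lemma sum_epsE (v : 'I_n -> R) w :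
  \sum_(i < n) v i * eps i w = signed_sum v (plus_spins w).
Proof. by apply: eq_bigr => i _; rewrite plus_spinsE. Qed.

Lemma prob_sum_eps (v : 'I_n -> R) (E : pred R) :
  P [set w | E (\sum_(i < n) v i * eps i w)] =
  (\sum_(A | E (signed_sum v A)) cw_atom #|A|)%:E.
Proof.
rewrite -(prob_plus_spins_in (fun A => E (signed_sum v A))).
by congr (P _); apply/seteqP; split=> w /=; rewrite sum_epsE.
Qed.

Lemma sum_eps1 w : \sum_(i < n) 1 * eps i w = \sum_(i < n) eps i w.
Proof. by apply: eq_bigr => i _; rewrite mul1r. Qed.

Lemma cw_atom_ge0 k : 0 <= cw_atom k.
Proof.
rewrite mulr_ge0 ?expR_ge0// invr_ge0 sumr_ge0// => c _; exact: expR_ge0.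
Qed.

(** The event is an antichain of configurations and the law is constant on
    levels, so the heaviest level dominates, uniformly in v and x. *)
Lemma prob_ball_le (v : 'I_n -> R) (x M : R) :
    (forall i, 1 <= v i) ->
    (forall k : 'I_n.+1, 'C(n, k)%:R * cw_atom k <= M) ->
  (P [set w | (\sum_(i < n) v i * eps i w \in `]x - 1, x + 1[)%R] <= M%:E)%E.
Proof.
move=> v1 leM.
rewrite (prob_sum_eps v (fun y => y \in `]x - 1, x + 1[)) lee_fin.
rewrite (eq_bigl (mem [set A | signed_sum v A \in `]x - 1, x + 1[]%SET)).
  apply: antichain_weight_le; first exact: signed_sum_antichain.
    by rewrite (le_trans _ (leM ord0))// mulr_ge0 ?cw_atom_ge0.
  by rewrite card_ord => k lekn; exact: (leM (Ordinal (lekn : (k < n.+1)%N))).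
by move=> A; rewrite !inE.
Qed.

(** With unit weights, the sum is 2 k - n exactly on the k-th level, which
    consists of 'C(n, k) equiprobable configurations. *)
Lemma prob_sum_eps_eq k :
  P [set w | \sum_(i < n) eps i w = 2 * k%:R - n%:R] =
  ('C(n, k)%:R * cw_atom k)%:E.
Proof.
have -> : [set w | \sum_(i < n) eps i w = 2 * k%:R - n%:R] =
    [set w | \sum_(i < n) 1 * eps i w == 2 * k%:R - n%:R].
  by apply/seteqP; split=> w /=; rewrite sum_eps1 => /eqP.
rewrite (prob_sum_eps (fun=> 1) (fun y => y == 2 * k%:R - n%:R)).
congr EFin; under eq_bigl => A.
  rewrite signed_sum1 (inj_eq (addIr _)) (inj_eq (mulfI _)) ?pnatr_eq0//.
  rewrite eqr_nat; over.
rewrite (eq_bigr (fun=> cw_atom k)) => [|A /eqP-> //].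
rewrite sumr_const -[LHS]mulr_natl -[X in 'C(X, _)]card_ord -card_draws.
by congr (_%:R * _); apply: eq_card => A; rewrite !inE.
Qed.

End CurieWeissLaw.

Theorem theorem1p2 (R : realType) (n d : nat) (beta h : R)
    (hn : (1 <= n)%N) (hd : (1 <= d)%N) (hbeta : 0 <= beta)
    (disp : measure_display) (T : measurableType disp)
    (P : probability T R) (eps : 'I_n -> {RV P >-> R})
    (heps : curie_weiss d beta h eps) :
  [/\ Qplus eps =
        ereal_sup [set P [set w | \sum_(i < n) eps i w \in `]x - 1, x + 1[]
                  | x in [set: R]],
      ereal_sup [set P [set w | \sum_(i < n) eps i w \in `]x - 1, x + 1[]
                | x in [set: R]] =
        ereal_sup [set P [set w | \sum_(i < n) eps i w = x] | x in [set: R]],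
      ereal_sup [set P [set w | \sum_(i < n) eps i w = x] | x in [set: R]] =
        \big[maxe/-oo%E]_(k < n.+1)
          ('C(n, k)%:R * (cw_Z n d beta h)^-1 *
           expR (d%:R * beta / n%:R * (2 * k%:R - n%:R) ^+ 2 +
                 h * (2 * k%:R - n%:R)))%:E
    & exists x : R,
        P [set w | \sum_(i < n) 1 * eps i w \in `]x - 1, x + 1[] = Qplus eps].
Proof.
pose g (k : 'I_n.+1) : R := 'C(n, k)%:R * @cw_atom R n d beta h k.
have [k0 leg] : {k0 | forall k, g k <= g k0}.
  by exists [arg max_(k > ord0) g k]%O; case: arg_maxP => // k _ gk j; exact: gk.
(* The location of the largest atom, and the centre of an optimal interval. *)
pose x0 : R := 2 * k0%:R - n%:R.
pose ball x := P [set w | \sum_(i < n) eps i w \in `]x - 1, x + 1[].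
pose atom x := P [set w | \sum_(i < n) eps i w = x].
have ball1 x : P [set w | \sum_(i < n) 1 * eps i w \in `]x - 1, x + 1[] = ball x.
  by congr (P _); apply/seteqP; split=> w /=; rewrite sum_eps1.
have ball_le x : (ball x <= (g k0)%:E)%E.
  by rewrite -ball1; exact: (prob_ball_le heps).
have measurable_sum_eps (Y : set R) : measurable Y ->
    measurable [set w | Y (\sum_(i < n) eps i w)].
  have mS : measurable_fun setT (fun w => \sum_(i < n) eps i w).
    by apply: measurable_sum => i; exact: measurable_funPT.
  by move=> mY; rewrite -[X in measurable X]setTI; exact: mS.
have m_ball x : measurable [set w | \sum_(i < n) eps i w \in `]x - 1, x + 1[].
  exact: (measurable_sum_eps [set` `]x - 1, x + 1[]).
have m_atom x : measurable [set w | \sum_(i < n) eps i w = x].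
  exact: (measurable_sum_eps [set x]).
have atom_le_ball x : (atom x <= ball x)%E.
  apply: le_measure; rewrite ?inE//.
  by move=> w /= ->; rewrite in_itv/=; apply/andP; split; lra.
have atom_x0 : atom x0 = (g k0)%:E by exact: (prob_sum_eps_eq heps).
have ball_x0 : ball x0 = (g k0)%:E.
  by apply/eqP; rewrite eq_le ball_le -atom_x0 atom_le_ball.
have QplusE : Qplus eps = (g k0)%:E.
  apply/eqP; rewrite eq_le; apply/andP; split.
    apply: ge_ereal_sup => _ [x _ <-]; apply: ge_ereal_sup => _ [v v1 <-].
    exact: (prob_ball_le heps).
  rewrite -ball_x0 -ball1; apply: le_trans; last first.
    by apply: ereal_sup_ubound; exists x0.
  by apply: ereal_sup_ubound; exists (fun=> 1).
have sup_ball : ereal_sup [set ball x | x in [set: R]] = (g k0)%:E.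
  apply/eqP; rewrite eq_le; apply/andP; split.
    by apply: ge_ereal_sup => _ [x _ <-].
  by rewrite -ball_x0; apply: ereal_sup_ubound; exists x0.
have sup_atom : ereal_sup [set atom x | x in [set: R]] = (g k0)%:E.
  apply/eqP; rewrite eq_le; apply/andP; split.
    by apply: ge_ereal_sup => _ [x _ <-]; rewrite (le_trans (atom_le_ball x)).
  by rewrite -atom_x0; apply: ereal_sup_ubound; exists x0.
have bigmax_g : \big[maxe/-oo%E]_(k < n.+1) (g k)%:E = (g k0)%:E.
  apply/le_anti/andP; split; last exact: (le_bigmax _ (fun k => (g k)%:E)).
  by apply: bigmax_le; rewrite ?leNye// => k _; rewrite lee_fin.
split.
- by rewrite QplusE sup_ball.
- by rewrite sup_ball sup_atom.
- by rewrite sup_atom -bigmax_g; apply: eq_bigr => k _; rewrite /g /cw_atom mulrA.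
- by exists x0; rewrite ball1 ball_x0 QplusE.
Qed.
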